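(* Let $n$ be a positive integer, and let $\alpha=\nu_2(n)$ and $\beta=\nu_3(n)$. Let $r,s,t$ be positive integers. Then the following hold in $\mathbb{Z}[q]$. (1) $$\genfrac{[}{]}{0pt}{}{6n}{n}_q^{-1}\sum_{k=-n}^{n}(-1)^kq^{\binom{k}{2}}\genfrac{[}{]}{0pt}{}{6n}{3n+k}_q^r\genfrac{[}{]}{0pt}{}{4n}{2n+k}_q^s\genfrac{[}{]}{0pt}{}{2n}{n+k}_q^t\equiv 0\pmod{[2]_{q^{2^\alpha}}}.$$ (2) $$\genfrac{[}{]}{0pt}{}{6n}{3n}_q^{-1}\sum_{k=-n}^{n}(-1)^kq^{\binom{k}{2}}\genfrac{[}{]}{0pt}{}{6n}{3n+k}_q^r\genfrac{[}{]}{0pt}{}{4n}{2n+k}_q^s\genfrac{[}{]}{0pt}{}{2n}{n+k}_q^t\equiv 0\pmod{[2]_{q^{2^\alpha}}[3]_{q^{3^\beta}}}.$$ (3) Put $$Q(q)=\genfrac{[}{]}{0pt}{}{8n}{3n}_q^{-1}\sum_{k=-n}^{n}(-1)^kq^{\binom{k}{2}}\genfrac{[}{]}{0pt}{}{8n}{4n+k}_q^r\genfrac{[}{]}{0pt}{}{4n}{2n+k}_q^s\genfrac{[}{]}{0pt}{}{2n}{n+k}_q^t.$$ Then: - if $t\geq 2$, then $Q(q)\equiv 0\pmod{[2]_{q^{2^\alpha}}}$; - if $s\geq 2$, or if $r\geq 2$ and $n\equiv 3\cdot 2^\alpha\pmod{2^{\alpha+2}}$, then $Q(q)\equiv 0\pmod{[2]_{q^{2^{\alpha+1}}}}$;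 - if $r\geq 2$ and $n\equiv 2^\alpha\pmod{2^{\alpha+2}}$, then $Q(q)\equiv 0\pmod{[2]_{q^{2^{\alpha+2}}}}$.
   Context: For a prime $p$ and a nonzero integer $m$, $\nu_p(m)$ is the greatest integer such that $p^{\nu_p(m)}\mid m$. For a positive integer $m$, $[m]_q=\frac{1-q^m}{1-q}=1+q+\cdots+q^{m-1}$, and $[m]_{q^a}$ denotes the result of replacing $q$ by $q^a$ in it, e.g. $[2]_{q^a}=1+q^a$ and $[3]_{q^a}=1+q^a+q^{2a}$. The $q$-binomial coefficient is $\genfrac{[}{]}{0pt}{}{m}{k}_q=\prod_{j=1}^k\frac{1-q^{m+1-j}}{1-q^j}$ if $m\geq k\geq 1$, equal to $1$ if $k=0$, and equal to $0$ if $k<0$ or $k>m$; it is a polynomial in $\mathbb{Z}[q]$. Here $\binom{k}{2}=k(k-1)/2$ for every integer $k$ (including negative $k$). A congruence of the form $B(q)^{-1}S(q)\equiv 0\pmod{M(q)}$ means that $S(q)=H(q)M(q)B(q)$ for some $H(q)\in\mathbb{Z}[q]$. *)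

(* Defs.v *)
From HB Require Import structures.
From mathcomp Require Export all_boot all_order all_algebra.
From mathcomp Require Import zify ring.
Set Implicit Arguments.
Unset Strict Implicit.
Unset Printing Implicit Defensive.
Import GRing.Theory Num.Theory.
Local Open Scope ring_scope.

(* The indeterminate q is 'X in {poly int}. *)

Definition qnat (m : nat) : {poly int} := \sum_(i < m) 'X^i.

Definition qnat_pow (m a : nat) : {poly int} := qnat m \Po 'X^a.

(* The leading coefficient of the divisor is +1 or -1, so %/ is Euclidean
   division in {poly int}; it is exact by qbinE below.  For k = 0 both products
   are empty and the value is 1 (qbin0). *)
Definition qbin (m : nat) (k : int) : {poly int} :=
  match k with
  | Posz k' =>
      if (k' <= m)%N then
        (\prod_(1 <= j < k'.+1) (1 - 'X^(m.+1 - j)))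
          %/ (\prod_(1 <= j < k'.+1) (1 - 'X^j))
      else 0
  | Negz _ => 0
  end.

(* k (k - 1) / 2 for every integer k; the value is never negative (zbin2E), so
   taking the absolute value only casts it to nat. *)
Definition zbin2 (k : int) : nat := `|((k * (k - 1)) %/ 2)%Z|%N.

(* The integers -n, ..., n. *)
Definition symrange (n : nat) : seq int :=
  [seq i%:Z - n%:Z | i <- iota 0 (2 * n).+1].

(* B(q)^-1 S(q) = 0 (mod M(q)) in Z[q]. *)
Definition qdiv_congr0 (B S M : {poly int}) : Prop :=
  exists H : {poly int}, S = H * M * B.

Lemma mem_symrange n (k : int) : (k \in symrange n) = (- n%:Z <= k <= n%:Z).
Proof.
apply/mapP/idP => [[i] | Hk]; first by rewrite mem_iota => /andP[_ Hi] ->; lia.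
by exists `|(k + n%:Z)%R|%N; rewrite ?mem_iota; lia.
Qed.

Lemma zbin2E (k : int) : (zbin2 k)%:Z * 2 = k * (k - 1).
Proof.
have ev : (2 %| k * (k - 1))%Z.
  have [j [->|->]] : exists j : int, k = j * 2 \/ k = j * 2 + 1.
  - by exists (k %/ 2)%Z; lia.
  - by rewrite -mulrA [2 * _]mulrC mulrA dvdz_mull.
  - by rewrite addrK mulrA dvdz_mull.
rewrite /zbin2 gez0_abs ?divzK // divz_ge0 //.
have [?|?] : k <= 0 \/ 1 <= k by lia.
  by nia.
by nia.
Qed.

Lemma qnat_powE (m a : nat) : qnat_pow m a = \sum_(i < m) 'X^(a * i).
Proof.
rewrite /qnat_pow /qnat linear_sum /=; apply: eq_bigr => i _.
by rewrite comp_Xn_poly -exprM.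
Qed.

Lemma qbin0 (m : nat) : qbin m 0 = 1.
Proof. by rewrite /qbin /= !big_nil Pdiv.Idomain.divp1. Qed.

Lemma qbin_dvd (m k : nat) : exists g : {poly int},
  \prod_(1 <= j < k.+1) (1 - 'X^(m.+1 - j))
    = g * \prod_(1 <= j < k.+1) (1 - 'X^j).
Proof.
rewrite !big_add1 /=.
under eq_bigr do rewrite subSS.
elim: m k => [|m IHm] [|k].
- by exists 1; rewrite !big_nil mulr1.
- by exists 0; rewrite big_nat_recl //= sub0n expr0 subrr !mul0r.
- by exists 1; rewrite !big_nil mulr1.
have [g Hg] := IHm k; have [h Hh] := IHm k.+1.
exists (g + 'X^(k.+1) * h); rewrite mulrDl -mulrA -Hh.
rewrite big_nat_recl // subn0; under eq_bigr do rewrite subSS.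
rewrite [in X in _ = g * X + _]big_nat_recr //= mulrA -Hg.
rewrite [in X in _ = _ + 'X^_ * X]big_nat_recr //=.
case: (leqP k m) => km.
  have -> : 'X^(m.+1) = 'X^(k.+1) * 'X^(m - k) :> {poly int}.
    by rewrite -exprD addSn subnKC.
  by ring.
have -> : \prod_(0 <= i < k) (1 - 'X^(m - i)) = 0 :> {poly int}.
  apply/eqP; rewrite big_mkord prodf_seq_eq0; apply/hasP.
  by exists (Ordinal km); rewrite ?mem_index_enum //= subnn expr0 subrr.
by ring.
Qed.

Lemma qbinE (m k : nat) : (k <= m)%N ->
  qbin m k * \prod_(1 <= j < k.+1) (1 - 'X^j)
    = \prod_(1 <= j < k.+1) (1 - 'X^(m.+1 - j)).
Proof.
move=> km; rewrite /qbin km; have [g ->] := qbin_dvd m k.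
rewrite Pdiv.IdomainUnit.mulpK // lead_coef_prod.
rewrite big_nat; apply: rpred_prod => j /andP[j_gt0 _].
by rewrite lead_coefDr ?lead_coefN ?lead_coefXn // size_polyN size_polyXn size_poly1.
Qed.

(* Main.v *)
Require Import Defs.
From mathcomp Require Import all_boot all_order all_algebra all_field.
From mathcomp Require Import zify ring.
Set Implicit Arguments.
Unset Strict Implicit.
Unset Printing Implicit Defensive.
Import GRing.Theory Num.Theory.
Local Open Scope ring_scope.

(** Divisibility is tested root by root: all roots of the moduli and of the
    q-binomial coefficients are roots of unity, so it suffices to compare
    multiplicities at a primitive d-th root of unity z. The multiplicity of z in
    the q-binomial coefficient [m; k] is the carry (0 or 1) of the addition
    k + (m - k) modulo d. Grouping the summands for k and - k produces a factor
    1 + q^k, which vanishes at z when k = d/2 modulo d. If z is a root of the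
    q-binomial coefficient on the left, then either every summand vanishes at z,
    or 3n (resp. 4n), 2n and n all have residue at least d/2 modulo d. In the
    latter case q-Lucas shows that replacing k = l d + j by (-1 - l) d + j changes
    the sign of every summand at z, so the sum vanishes. At the order d attached
    to the factor [2] of the modulus the same count, with the factor 1 + q^k,
    gives multiplicity two. *)

Local Arguments qbin : simpl never.

Local Notation pZto R := (map_poly (intr : int -> R)).

(** * Multiplicities of roots *)

Lemma prim_expr_half (R : idomainType) d h (z : R) :
  d.-primitive_root z -> d = h.*2 -> z ^+ h = -1.
Proof.
move=> zP dE; have d_gt0 := prim_order_gt0 zP.
have : (z ^+ h) ^+ 2 == 1 by rewrite -exprM muln2 -dE prim_expr_order.
rewrite sqrf_eq1 => /orP[|/eqP//]; rewrite -(prim_order_dvd zP).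
by move=> /dvdn_leq; lia.
Qed.

Lemma mup_separable (F : fieldType) (p : {poly F}) x :
  separable_poly p -> mup x p = root p x.
Proof.
move=> sep_p; case: (boolP (root p x)) => px; last exact: mupNroot.
have p0 := separable_poly_neq0 sep_p.
apply/eqP; rewrite eqn_leq mup_leq // -XsubC_dvd // dvdp_XsubCl px andbT.
by rewrite separable_nosquare // size_XsubC.
Qed.

Lemma mup_1subXn (F : numFieldType) (x : F) j : (0 < j)%N ->
  mup x (1 - 'X^j) = (x ^+ j == 1).
Proof.
move=> j_gt0; rewrite mup_separable ?/root ?hornerE 1?subr_eq0 1?eq_sym //.
rewrite -opprB -scaleN1r (eqp_separable (eqp_scale _ _)) ?oppr_eq0 ?oner_eq0 //.
by apply: separable_Xn_sub_1; rewrite pnatr_eq0 -lt0n.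
Qed.

Lemma dvdp_mup (F : closedFieldType) (p q : {poly F}) : p != 0 -> q != 0 ->
  (forall x, (mup x p <= mup x q)%N) -> p %| q.
Proof.
have [r pE] := closed_field_poly_normal p; have [s qE] := closed_field_poly_normal q.
rewrite -lead_coef_eq0 -[q == 0]lead_coef_eq0.
move: (lead_coef p) (lead_coef q) pE qE => a b -> -> a0 b0 le_mup.
rewrite dvdpZl // dvdpZr //.
have /count_subseqP[t /subseqP[m _ ->] rt] :
    forall x, (count_mem x r <= count_mem x s)%N.
  by move=> x; have := le_mup x; rewrite -!mul_polyC !mupMr ?rootC // !mu_prod_XsubC.
rewrite (perm_big _ rt); elim: s m {le_mup rt} => [|x s IH] [|[] m] //=.
- by rewrite big_nil dvd1p.
- by rewrite !big_cons dvdp_mul2l ?polyXsubC_eq0.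
- by rewrite big_cons dvdp_mull.
Qed.

Lemma map_intr_poly_eq0 (R : numDomainType) (p : {poly int}) :
  (pZto R p == 0) = (p == 0).
Proof. by rewrite -!size_poly_eq0 size_map_inj_poly //; apply: intr_inj. Qed.

Lemma dvdp_map_intr (F : numFieldType) (p q : {poly int}) :
  (pZto F p %| pZto F q) = (p %| q).
Proof.
have ratrE s : pZto F s = map_poly ratr (pZto rat s).
  by rewrite -map_poly_comp; apply: eq_map_poly => c /=; rewrite ratr_int.
by rewrite !ratrE dvdp_map dvdp_rat_int.
Qed.

Lemma map_intr_1subXn (R : numDomainType) j : pZto R (1 - 'X^j) = 1 - 'X^j.
Proof. by rewrite rmorphB rmorph1 /= map_polyXn. Qed.

(** * The q-binomial coefficients *)

Definition qpoch (m : nat) : {poly int} := \prod_(1 <= j < m.+1) (1 - 'X^j).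

Lemma qpochS m : qpoch m.+1 = qpoch m * (1 - 'X^(m.+1)).
Proof. by rewrite /qpoch big_nat_recr. Qed.

Lemma lead_coef_1subXn_unit j : (0 < j)%N ->
  lead_coef (1 - 'X^j : {poly int}) \is a GRing.unit.
Proof.
move=> j_gt0; rewrite lead_coefDr ?lead_coefN ?lead_coefXn //.
by rewrite size_polyN size_polyXn size_poly1.
Qed.

Lemma lead_unit_neq0 (R : unitRingType) (p : {poly R}) :
  lead_coef p \is a GRing.unit -> p != 0.
Proof. by apply: contraTneq => ->; rewrite lead_coef0 unitr0. Qed.

Lemma qpoch_neq0 m : qpoch m != 0.
Proof.
rewrite /qpoch prodf_seq_neq0; apply/allP => j.
rewrite mem_index_iota => /andP[j_gt0 _].
exact/lead_unit_neq0/lead_coef_1subXn_unit.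
Qed.

Lemma qbin_qpoch m k : (k <= m)%N ->
  qbin m k%:Z * qpoch k * qpoch (m - k) = qpoch m.
Proof.
move=> km; rewrite /qpoch qbinE // -/(qpoch _) -/(qpoch _).
elim: k km => [|k IH] km; first by rewrite big_nil mul1r subn0.
rewrite -(IH (ltnW km)) big_nat_recr //= subSS -mulrA; congr (_ * _).
by rewrite -(subnSK km) qpochS mulrC.
Qed.

Lemma qbin_neq0 m k : (k <= m)%N -> qbin m k%:Z != 0.
Proof.
move=> km; have := qpoch_neq0 m.
by rewrite -(qbin_qpoch km) !mulf_eq0 !negb_or => /andP[/andP[]].
Qed.

Lemma qbin_out m (k : int) : ~~ (0 <= k <= m%:Z) -> qbin m k = 0.
Proof. by case: k => // k; rewrite /qbin /= lez_nat => /negPf->. Qed.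

Lemma qbin_sub m (k : int) : qbin m (m%:Z - k) = qbin m k.
Proof.
have [/andP[]|km] := boolP (0 <= k <= m%:Z); last by rewrite !qbin_out //; lia.
case: k => // k _; rewrite lez_nat => km; rewrite subzn //.
have := qbin_qpoch (leq_subr k m); rewrite -(qbin_qpoch km) subKn // mulrAC.
by move=> /(mulIf (qpoch_neq0 _))/(mulIf (qpoch_neq0 _)).
Qed.

Lemma qbinn m : qbin m m%:Z = 1.
Proof. by rewrite -qbin_sub subrr qbin0. Qed.

Lemma qbinS m (k : int) :
  qbin m.+1 k = 'X^`|k| * qbin m k + qbin m (k - 1).
Proof.
case: k => [[|i]|i]; last by rewrite !qbin_out ?mulr0 ?addr0.
  by rewrite !qbin0 (@qbin_out _ (0 - 1)) // expr0 mulr1 addr0.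
rewrite (_ : i.+1%:Z - 1 = i); last by lia.
case: (ltngtP i m) => [im|im|->]; last 1 first.
- by rewrite !qbinn qbin_out ?mulr0 ?add0r //; lia.
- apply: (mulIf (qpoch_neq0 i.+1)); apply: (mulIf (qpoch_neq0 (m - i))).
  rewrite -{1}[(m - i)%N]subSS qbin_qpoch; last by lia.
  transitivity ('X^(i.+1) * (1 - 'X^(m - i)) * qpoch m + (1 - 'X^(i.+1)) * qpoch m).
    have mE : m.+1 = (i.+1 + (m - i))%N by lia.
    by rewrite qpochS mE exprD; ring.
  rewrite -{1}(qbin_qpoch im) -{1}(qbin_qpoch (ltnW im)) -(subnSK im) !qpochS; ring.
- by rewrite !qbin_out ?mulr0 ?addr0 //; lia.
Qed.

Lemma qnat_powM m a : qnat_pow m a * (1 - 'X^a) = 1 - 'X^(a * m).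
Proof.
rewrite qnat_powE; elim: m => [|m IH]; first by rewrite big_ord0 muln0 subrr mul0r.
rewrite big_ord_recr mulrDl IH /= mulnS exprD; ring.
Qed.

Section UnityRooted.

Variable R : numDomainType.

Definition unity_rooted (p : {poly int}) : Prop :=
  lead_coef p \is a GRing.unit
  /\ forall z : R, root (pZto R p) z -> exists d, d.-primitive_root z.

Lemma unity_rooted_neq0 p : unity_rooted p -> p != 0.
Proof. by case=> /lead_unit_neq0. Qed.

Lemma unity_rootedM p q : unity_rooted (p * q) <-> unity_rooted p /\ unity_rooted q.
Proof.
rewrite /unity_rooted lead_coefM unitrM; split.
  case=> /andP[up uq] rpq; split; split=> // z rz; apply: rpq.
    by rewrite rmorphM rootM rz.
  by rewrite rmorphM rootM rz orbT.
move=> [[up rp] [uq rq]]; split=> [|z]; first by rewrite up.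
by rewrite rmorphM rootM => /orP[/rp|/rq].
Qed.

Lemma unity_rooted_1subXn j : (0 < j)%N -> unity_rooted (1 - 'X^j).
Proof.
move=> j_gt0; split=> [|z]; first exact: lead_coef_1subXn_unit.
rewrite map_intr_1subXn /root !hornerE subr_eq0 eq_sym => /eqP zj.
by have [d zP _] := prim_order_exists j_gt0 zj; exists d.
Qed.

Lemma unity_rooted_qbin m k : (k <= m)%N -> unity_rooted (qbin m k%:Z).
Proof.
move=> km; suff : unity_rooted (qpoch m).
  by rewrite -(qbin_qpoch km) !unity_rootedM => -[[]].
elim: m {km} => [|m IH].
  rewrite /qpoch big_nil; split=> [|z]; first by rewrite lead_coef1 unitr1.
  by rewrite rmorph1 (negPf (root1 z)).
by rewrite qpochS unity_rootedM; split=> //; exact: unity_rooted_1subXn.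
Qed.

Lemma unity_rooted_qnat_pow m a : (0 < m)%N -> (0 < a)%N -> unity_rooted (qnat_pow m a).
Proof.
move=> m_gt0 a_gt0; have : unity_rooted (1 - 'X^(a * m)).
  by apply: unity_rooted_1subXn; rewrite muln_gt0 a_gt0.
by rewrite -qnat_powM unity_rootedM => -[].
Qed.

Lemma unity_rooted_qnat_pow_prime p e : prime p -> unity_rooted (qnat_pow p (p ^ e)).
Proof.
by move=> /prime_gt0 p_gt0; apply: unity_rooted_qnat_pow; rewrite ?expn_gt0 ?p_gt0.
Qed.

End UnityRooted.

(** * Carries modulo d *)

Definition dist_multiple (d k : nat) : nat := minn (k %% d) (d - k %% d).

Definition large_residue (d a : nat) : bool := (d <= 2 * (a %% d))%N.

Definition carry (d a k : nat) : bool :=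
  if large_residue d a then (dist_multiple d k < d - a %% d)%N
  else (a %% d < dist_multiple d k)%N.

Lemma carryE d a k : (0 < d)%N -> (k <= a)%N ->
  carry d a k = (d <= (a + k) %% d + (a - k) %% d)%N.
Proof.
move=> d_gt0 ka; have := modnD (a - k) k d_gt0; rewrite subnK // modnD //.
rewrite /carry /large_residue /dist_multiple.
have := ltn_pmod a d_gt0; have := ltn_pmod k d_gt0; have := ltn_pmod (a - k) d_gt0.
move: (a %% d)%N (k %% d)%N ((a - k) %% d)%N => v u x xd ud vd.
case: (leqP d (x + u)); case: (leqP d (v + u)); case: (leqP d (2 * v));
  rewrite ?mul1n ?mul0n /=; lia.
Qed.

Lemma carry_dvdl d a k : (0 < d)%N -> (d %| a)%N -> carry d a k = ~~ (d %| k)%N.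
Proof.
rewrite /carry /large_residue /dist_multiple /dvdn => d_gt0 /eqP->.
by have := ltn_pmod k d_gt0; case: ifP; lia.
Qed.

Lemma carry_dvdr d a k : (0 < d)%N -> (d %| k)%N -> carry d a k = large_residue d a.
Proof.
rewrite /carry /large_residue /dist_multiple /dvdn => d_gt0 /eqP->.
by have := ltn_pmod a d_gt0; case: ifP; lia.
Qed.

Lemma carry_halfl d a k : (0 < d)%N -> (a %% d).*2 = d ->
  carry d a k = ((k %% d).*2 != d).
Proof.
move=> d_gt0 a_half; rewrite /carry /large_residue /dist_multiple.
by have := ltn_pmod k d_gt0; case: ifP; lia.
Qed.

Lemma carry_halfr d a k : (0 < d)%N -> (k %% d).*2 = d ->
  carry d a k = ~~ large_residue d a.
Proof.
move=> d_gt0 k_half; rewrite /carry /large_residue /dist_multiple.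
by have := ltn_pmod a d_gt0; case: ifP; lia.
Qed.

(** * Multiplicities at a primitive root of unity *)

Section PrimitiveRoot.

Variables (F : numFieldType) (d : nat) (z : F).
Hypothesis zP : d.-primitive_root z.

Let d_gt0 : (0 < d)%N := prim_order_gt0 zP.

Lemma mup_qpoch m : mup z (pZto F (qpoch m)) = (m %/ d)%N.
Proof.
elim: m => [|m IH]; first by rewrite /qpoch big_nil rmorph1 mupNroot ?root1 ?div0n.
have := qpoch_neq0 m.+1; rewrite qpochS mulf_eq0 negb_or => /andP[p0 x0].
rewrite rmorphM mupM ?map_intr_poly_eq0 //= IH map_intr_1subXn mup_1subXn //.
by rewrite -(prim_order_dvd zP) divnS // addnC.
Qed.

Lemma mup_qbin m k : (k <= m)%N ->
  mup z (pZto F (qbin m k%:Z)) = (d <= k %% d + (m - k) %% d)%N.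
Proof.
move=> km; have := mup_qpoch m; rewrite -(qbin_qpoch km) !rmorphM /=.
rewrite !mupM ?mulf_neq0 ?map_intr_poly_eq0 ?qpoch_neq0 ?qbin_neq0 // !mup_qpoch.
have := divnD k (m - k) d_gt0; rewrite subnKC // => ->.
by rewrite -addnA addnC => /addnI.
Qed.

Lemma mup_qbin_central a k : (k <= a)%N ->
  mup z (pZto F (qbin (2 * a) (a%:Z + k%:Z))) = carry d a k.
Proof.
move=> ka; rewrite carryE // -PoszD mup_qbin; last by lia.
by rewrite (_ : 2 * a - (a + k) = a - k)%N //; lia.
Qed.

End PrimitiveRoot.

Lemma mup_qnat_pow_prime (F : numFieldType) (z : F) p e d :
  prime p -> d.-primitive_root z ->
  mup z (pZto F (qnat_pow p (p ^ e))) = (d == p ^ e.+1)%N.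
Proof.
move=> p_pr zP; have p_gt0 := prime_gt0 p_pr.
have pe_gt0 : (0 < p ^ e)%N by rewrite expn_gt0 p_gt0.
have : mup z (pZto F (1 - 'X^(p ^ e * p))) = (d %| p ^ e.+1)%N.
  rewrite map_intr_1subXn mup_1subXn ?muln_gt0 ?pe_gt0 //.
  by rewrite -(prim_order_dvd zP) -expnSr.
rewrite -qnat_powM rmorphM /= mupM ?map_intr_poly_eq0; last 2 first.
- exact: unity_rooted_neq0 (unity_rooted_qnat_pow_prime F e p_pr).
- exact: unity_rooted_neq0 (unity_rooted_1subXn F pe_gt0).
rewrite map_intr_1subXn mup_1subXn // -(prim_order_dvd zP).
have [->|d_neq] := eqVneq d (p ^ e.+1)%N.
  by rewrite dvdnn (dvdn_Pexp2l _ _ (prime_gt1 p_pr)) ltnn addn0.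
suff -> : (d %| p ^ e.+1)%N = (d %| p ^ e)%N.
  by rewrite -[in RHS](add0n (d %| _)%N) => /addIn.
apply/idP/idP => [/(dvdn_pfactor _ _ p_pr)[i i_le dE]|]; last first.
  by move/dvdn_trans; apply; rewrite dvdn_exp2l.
rewrite dE dvdn_exp2l // -ltnS ltn_neqAle i_le andbT.
by apply: contraNneq d_neq => <-; rewrite dE.
Qed.

Lemma mup_qnat_pow_primeM (F : numFieldType) (z : F) p1 p2 e1 e2 d :
  prime p1 -> prime p2 -> d.-primitive_root z ->
  mup z (pZto F (qnat_pow p1 (p1 ^ e1) * qnat_pow p2 (p2 ^ e2)))
  = ((d == p1 ^ e1.+1) + (d == p2 ^ e2.+1))%N.
Proof.
move=> p1_pr p2_pr zP.
have q1_neq0 := unity_rooted_neq0 (unity_rooted_qnat_pow_prime F e1 p1_pr).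
have q2_neq0 := unity_rooted_neq0 (unity_rooted_qnat_pow_prime F e2 p2_pr).
by rewrite rmorphM /= mupM ?map_intr_poly_eq0 // !(mup_qnat_pow_prime _ _ zP).
Qed.

Lemma qdiv_congr0_mup (C : numClosedFieldType) B S M :
  unity_rooted C B -> unity_rooted C M ->
  (forall d (z : C), d.-primitive_root z -> S != 0 ->
     (mup z (pZto C M) + mup z (pZto C B) <= mup z (pZto C S))%N) ->
  qdiv_congr0 B S M.
Proof.
move=> uB uM le_mup.
have [lead_MB root_MB] : unity_rooted C (M * B) by exact/unity_rootedM.
have [->|S0] := eqVneq S 0; first by exists 0; rewrite !mul0r.
suff /eqP SE : S == S %/ (M * B) * (M * B) by exists (S %/ (M * B)); rewrite -mulrA.
have [M0 B0] := (unity_rooted_neq0 uM, unity_rooted_neq0 uB).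
rewrite -Pdiv.IdomainUnit.dvdp_eq // -(dvdp_map_intr C).
apply: dvdp_mup => [||z]; rewrite ?map_intr_poly_eq0 ?mulf_neq0 //.
have [/root_MB[d zP]|/mupNroot-> //] := boolP (root (pZto C (M * B)) z).
by rewrite rmorphM mupM ?map_intr_poly_eq0 // (le_mup d).
Qed.

Lemma qdiv_congr0_qbin_qnat_pow (C : numClosedFieldType) m j p e S :
  prime p -> (j <= m)%N ->
  (forall d (z : C), d.-primitive_root z -> S != 0 -> (d <= j %% d + (m - j) %% d)%N ->
     (0 < mup z (pZto C S))%N) ->
  (forall z : C, (p ^ e.+1).-primitive_root z -> S != 0 -> (1 < mup z (pZto C S))%N) ->
  qdiv_congr0 (qbin m j%:Z) S (qnat_pow p (p ^ e)).
Proof.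
move=> p_pr jm simple double; apply: (@qdiv_congr0_mup C).
- exact: unity_rooted_qbin.
- exact: unity_rooted_qnat_pow_prime.
move=> d z zP S0; rewrite (mup_qnat_pow_prime _ _ zP) // (mup_qbin zP) //.
case: (d =P (p ^ e.+1)%N) => [dE|_].
  by apply: leq_trans (double z _ S0); rewrite -?dE // ltnS leq_b1.
by case: (leqP d (_ + _)) => // /(simple d z zP S0).
Qed.

(** * Evaluation at a primitive root of unity *)

Definition binz (m : nat) (c : int) : nat := if c is Posz c' then 'C(m, c') else 0%N.

Lemma binz_out m (c : int) : ~~ (0 <= c <= m%:Z) -> binz m c = 0%N.
Proof. by case: c => //= c; rewrite lez_nat -ltnNge => /bin_small. Qed.

Lemma binz_sub m (c : int) : binz m (m%:Z - c) = binz m c.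
Proof.
have [/andP[]|cm] := boolP (0 <= c <= m%:Z); last by rewrite !binz_out //; lia.
by case: c => // c _; rewrite lez_nat => cm; rewrite subzn //= bin_sub.
Qed.

Lemma binzS m (c : int) : binz m.+1 c = (binz m c + binz m (c - 1))%N.
Proof. by case: c => [[|c]|c] //=; rewrite ?bin0 // binS subn1. Qed.

Definition qbin_at (R : numDomainType) (z : R) m (k : int) : R :=
  (pZto R (qbin m k)).[z].

Lemma qbin_at_out (R : numDomainType) (z : R) m (k : int) :
  ~~ (0 <= k <= m%:Z) -> qbin_at z m k = 0.
Proof. by move=> km; rewrite /qbin_at qbin_out // rmorph0 horner0. Qed.

Lemma qbin_at0 (R : numDomainType) (z : R) m : qbin_at z m 0 = 1.
Proof. by rewrite /qbin_at qbin0 rmorph1 hornerE. Qed.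

Lemma qbin_atS (F : numFieldType) (z : F) m (k : int) :
  qbin_at z m.+1 k = z ^ k * qbin_at z m k + qbin_at z m (k - 1).
Proof.
rewrite /qbin_at qbinS rmorphD rmorphM /= map_polyXn !hornerE.
by case: k => // k; rewrite (@qbin_out m) // rmorph0 horner0 !mulr0.
Qed.

Lemma exprN1_abs (R : unitRingType) (k : int) : (-1) ^ k = (-1) ^+ `|k|%N :> R.
Proof. by case: k => k //; rewrite NegzE -exprz_inv invrN1. Qed.

Definition qsign (R : unitRingType) (z : R) (k : int) : R := (-1) ^ k * z ^+ zbin2 k.

Lemma zbin2D (k l : int) : (zbin2 (k + l))%:Z = (zbin2 k)%:Z + (zbin2 l)%:Z + k * l.
Proof. by have := zbin2E (k + l); have := zbin2E k; have := zbin2E l; nia. Qed.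

Lemma qsignD (F : fieldType) (z : F) (k l : int) : z != 0 ->
  qsign z (k + l) = qsign z k * qsign z l * z ^ (k * l).
Proof.
move=> z0; have m1 : -1 != 0 :> F by rewrite oppr_eq0 oner_eq0.
by rewrite /qsign !exprnP zbin2D !expfzDr //; ring.
Qed.

Section EvaluationAtPrimitiveRoot.

Variables (F : numFieldType) (d : nat) (z : F).
Hypothesis zP : d.-primitive_root z.

Let d_gt0 : (0 < d)%N := prim_order_gt0 zP.

Let z_neq0 : z != 0.
Proof. by rewrite (prim_root_eq0 zP) -lt0n. Qed.

Let exprz_order : z ^ d%:Z = 1.
Proof. exact: prim_expr_order zP. Qed.

Lemma qbin_at_order (k : int) : qbin_at z d k = (k == 0)%:R + (k == d%:Z)%:R.
Proof.
have [->|k0] := eqVneq k 0.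
  by rewrite qbin_at0 (_ : (_ == _) = false) ?addr0 //; lia.
have [->|kd] := eqVneq k d%:Z.
  by rewrite /qbin_at qbinn rmorph1 hornerE add0r.
rewrite addr0; have [/andP[]|] := boolP (0 <= k <= d%:Z); last exact: qbin_at_out.
case: k k0 kd => // k k0 kd _ k_le; apply/eqP; rewrite -[_ == _]/(root _ z).
apply/negPn/negP => /mupNroot; rewrite (mup_qbin zP) //.
by rewrite !modn_small ?subnKC ?leqnn //; lia.
Qed.

Lemma qbin_at_period m (k : int) :
  qbin_at z (m + d) k = qbin_at z m k + qbin_at z m (k - d%:Z).
Proof.
have qbin_at_0l (j : int) : qbin_at z 0 j = (j == 0)%:R.
  have [->|j0] := eqVneq j 0; first exact: qbin_at0.
  by apply: qbin_at_out; lia.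
elim: m k => [|m IH] k; first by rewrite qbin_at_order !qbin_at_0l subr_eq0.
rewrite addSn !qbin_atS !IH (_ : k - 1 - d%:Z = k - d%:Z - 1); last by ring.
rewrite expfzDr // -invr_expz exprz_order invr1 mulr1; ring.
Qed.

Lemma qbin_at_lucas a b (c : int) f : (b < d)%N -> (f < d)%N ->
  qbin_at z (a * d + b) (c * d%:Z + f%:Z) = (binz a c)%:R * qbin_at z b f%:Z.
Proof.
move=> bd fd; elim: a c => [|a IH] c.
  rewrite add0n; have [->|c0] := eqVneq c 0; first by rewrite mul0r add0r mul1r.
  have cd : c * d%:Z <= - d%:Z \/ d%:Z <= c * d%:Z.
    have [c_lt0|c_gt0] : c <= -1 \/ 1 <= c by lia.
      by left; nia.
    by right; nia.
  by rewrite binz_out ?mul0r ?qbin_at_out //; lia.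
rewrite mulSnr addnAC qbin_at_period.
rewrite (_ : _ - d%:Z = (c - 1) * d%:Z + f%:Z); last by ring.
by rewrite !IH binzS natrD mulrDl.
Qed.

(* If u is the quotient of a by d, then 2u + 1 is that of 2a, and q-Lucas turns
   the two sides into multiples of 'C(2u + 1, u - l) and 'C(2u + 1, u + l + 1). *)
Lemma qbin_at_flip a (l : int) f : large_residue d a -> (f < d)%N ->
  qbin_at z (2 * a) (a%:Z + ((-1 - l) * d%:Z + f%:Z))
  = qbin_at z (2 * a) (a%:Z + (l * d%:Z + f%:Z)).
Proof.
rewrite /large_residue; have := ltn_pmod a d_gt0; have := divn_eq a d.
move: (a %/ d)%N (a %% d)%N => u v -> {a} vd large_v fd.
have -> : (2 * (u * d + v) = (2 * u + 1) * d + (2 * v - d))%N by lia.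
have [small|large] := ltnP (v + f)%N d.
  have lucas0 (c : int) :
      qbin_at z ((2 * u + 1) * d + (2 * v - d)) (c * d%:Z + (v + f)%N%:Z) = 0.
    by rewrite qbin_at_lucas ?(@qbin_at_out _ _ (2 * v - d)) ?mulr0 //; lia.
  transitivity (0 : F); [rewrite -[RHS](lucas0 (u%:Z - 1 - l))
                        | rewrite -[LHS](lucas0 (u%:Z + l))]; congr qbin_at; lia.
pose c := u%:Z + l + 1; pose g := (v + f - d)%N.
transitivity (qbin_at z ((2 * u + 1) * d + (2 * v - d))
                ((((2 * u + 1)%N%:Z - c) * d%:Z + g%:Z))).
  by congr qbin_at; rewrite /c /g; lia.
rewrite qbin_at_lucas ?binz_sub -?qbin_at_lucas /g; [|lia..].
by congr qbin_at; rewrite /c; lia.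
Qed.

Lemma qsign_order : qsign z d%:Z = -1.
Proof.
have zbin2d := zbin2E d.
have [h [dE|dE]] : exists h : nat, d = h.*2 \/ d = h.*2.+1 by exists d./2; lia.
- rewrite /qsign (_ : zbin2 d = h * d.-1)%N; last by nia.
  rewrite exprM (prim_expr_half zP dE) -exprnP -exprD -signr_odd.
  by rewrite (_ : odd _) ?expr1 //; lia.
- rewrite /qsign (_ : zbin2 d = d * h)%N; last by nia.
  rewrite exprM (prim_expr_order zP) expr1n mulr1 -exprnP -signr_odd.
  by rewrite dE /= odd_double expr1.
Qed.

Lemma qsign_mul_order (j : int) : qsign z (j * d%:Z) = (-1) ^ j.
Proof.
have m1 : -1 != 0 :> F by rewrite oppr_eq0 oner_eq0.
have step (i : int) : qsign z ((i + 1) * d%:Z) = - qsign z (i * d%:Z).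
  rewrite mulrDl mul1r qsignD // qsign_order mulrN1.
  by rewrite [i * _]mulrC -mulrA -exprz_exp exprz_order exp1rz mulr1.
elim: j => [|j IH|j IH]; first by rewrite mul0r /qsign expr0z mul1r.
- by rewrite -addn1 PoszD step IH expfzDr // expr1z mulrN1.
- apply: oppr_inj; rewrite -step (_ : - j.+1%:Z + 1 = - j%:Z) ?IH; last by lia.
  by rewrite (_ : - j%:Z = - j.+1%:Z + 1) ?expfzDr ?expr1z ?mulrN1 //; lia.
Qed.

Lemma qsign_flip (l : int) f :
  qsign z ((-1 - l) * d%:Z + f%:Z) = - qsign z (l * d%:Z + f%:Z).
Proof.
rewrite !qsignD // !qsign_mul_order !(mulrAC _ d%:Z) !(mulrC _ d%:Z) -!exprz_exp.
rewrite exprz_order !exp1rz !mulr1 -mulNr; congr (_ * _).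
by rewrite !exprN1_abs -signr_odd -[in RHS]signr_odd -signrN; congr (_ ^+ _); lia.
Qed.

End EvaluationAtPrimitiveRoot.

(** * Sums over symmetric ranges *)

Lemma big_symrange_nat (V : nmodType) n (f : int -> V) :
  \sum_(k <- symrange n) f k = \sum_(0 <= i < (2 * n).+1) f (i%:Z - n%:Z).
Proof. by rewrite /symrange big_map /index_iota subn0. Qed.

Lemma big_symrangeS (V : nmodType) n (f : int -> V) :
  \sum_(k <- symrange n.+1) f k
  = \sum_(k <- symrange n) f k + (f n.+1%:Z + f (- n.+1%:Z)).
Proof.
rewrite !big_symrange_nat.
have -> : ((2 * n.+1).+1 = (2 * n).+1.+2)%N by lia.
rewrite big_nat_recl // big_nat_recr //= [LHS]addrC -addrA.
congr (_ + (f _ + f _)); [|lia..].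
by apply: eq_bigr => i _; congr f; lia.
Qed.

Lemma big_symrange_fold (V : nmodType) n (f : int -> V) :
  \sum_(k <- symrange n) f k = f 0 + \sum_(1 <= k < n.+1) (f k%:Z + f (- k%:Z)).
Proof.
elim: n => [|n IH]; first by rewrite big_nil addr0 /symrange /= big_seq1.
by rewrite big_symrangeS IH [in RHS]big_nat_recr //= -[LHS]addrA.
Qed.

Lemma big_symrange_widen (V : nmodType) n m (f : int -> V) : (n <= m)%N ->
  (forall k, n%:Z < `|k| -> f k = 0) ->
  \sum_(k <- symrange n) f k = \sum_(k <- symrange m) f k.
Proof.
move=> /subnKC <- f0; elim: (m - n)%N => [|i IH]; first by rewrite addn0.
by rewrite addnS big_symrangeS -IH !f0 ?addr0 //; lia.
Qed.

Lemma big_symrange_blocks (V : nmodType) d N (f : int -> V) : f (N * d)%N%:Z = 0 ->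
  \sum_(k <- symrange (N * d)) f k
  = \sum_(0 <= i < 2 * N) \sum_(0 <= j < d) f ((i%:Z - N%:Z) * d%:Z + j%:Z).
Proof.
move=> fNd; rewrite big_symrange_nat big_nat_recr //=.
rewrite (_ : _ - _ = (N * d)%N%:Z); last by lia.
rewrite fNd addr0 mulnA big_nat_mul; apply: eq_bigr => i _.
rewrite -{1}[(i * d)%N]add0n big_addn mulSn addnK.
by apply: eq_bigr => j _; congr f; lia.
Qed.

Lemma big_symrange_flip (R : numDomainType) d n (f : int -> R) : (0 < d)%N ->
  (forall k, n%:Z < `|k| -> f k = 0) ->
  (forall l j, (j < d)%N -> f ((-1 - l) * d%:Z + j%:Z) = - f (l * d%:Z + j%:Z)) ->
  \sum_(k <- symrange n) f k = 0.
Proof.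
move=> d_gt0 f0 f_flip; rewrite (@big_symrange_widen _ n (n.+1 * d)) //; last by nia.
rewrite big_symrange_blocks; last by apply: f0; nia.
set S := \sum_(_ <= i < _) _.
have S_opp : S = - S.
  rewrite {1}/S big_nat_rev -sumrN big_nat [RHS]big_nat; apply: eq_bigr => i i_lt.
  rewrite -sumrN big_nat [RHS]big_nat; apply: eq_bigr => j /andP[_ jd].
  by rewrite -f_flip //; congr (f (_ * _ + _)); lia.
have : S *+ 2 == 0 by rewrite mulr2n {1}S_opp addNr.
by rewrite mulrn_eq0 => /eqP.
Qed.

(** * Alternating sums of products of central q-binomial coefficients *)

(* An entry (a, r) of ws stands for the factor [2a; a + k]^r. *)
Definition altterm (ws : seq (nat * nat)) (k : int) : {poly int} :=
  (-1) ^ k * 'X^(zbin2 k) * \prod_(w <- ws) qbin (2 * w.1) (w.1%:Z + k) ^+ w.2.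

Definition altsum (n : nat) (ws : seq (nat * nat)) : {poly int} :=
  \sum_(k <- symrange n) altterm ws k.

Lemma altterm_opp ws (k : nat) : altterm ws (- k%:Z) = altterm ws k%:Z * 'X^k.
Proof.
rewrite /altterm !exprN1_abs abszN; have -> : zbin2 (- k%:Z) = (zbin2 k + k)%N.
  by have := zbin2E k; have := zbin2E (- k%:Z); nia.
rewrite exprD mulrA [RHS]mulrAC; congr (_ * _); apply: eq_bigr => w _.
by rewrite -qbin_sub; congr (qbin _ _ ^+ _); lia.
Qed.

Lemma altterm_out n ws (k : int) : has (fun w => (w.1 <= n) && (0 < w.2))%N ws ->
  n%:Z < `|k| -> altterm ws k = 0.
Proof.
move=> /hasP[w w_ws /andP[wn w_gt0]] nk; rewrite /altterm.
rewrite (big_rem w) //= qbin_out ?expr0n ?gtn_eqF ?mul0r ?mulr0 //; lia.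
Qed.

Lemma altterm_at (R : numDomainType) (z : R) ws k : (pZto R (altterm ws k)).[z]
  = qsign z k * \prod_(w <- ws) qbin_at z (2 * w.1) (w.1%:Z + k) ^+ w.2.
Proof.
rewrite /altterm /qsign !exprN1_abs !rmorphM rmorph_prod !rmorphXn /=.
rewrite map_polyX rmorphN1.
rewrite !(hornerM, horner_exp, hornerX, hornerN, hornerC) horner_prod.
by congr (_ * _); apply: eq_bigr => w _; rewrite rmorphXn horner_exp.
Qed.

Section AltsumAtPrimitiveRoot.

Variables (F : numFieldType) (d : nat) (z : F) (n : nat) (ws : seq (nat * nat)).
Hypothesis zP : d.-primitive_root z.

Lemma root_altsum_large : has (fun w => (w.1 <= n) && (0 < w.2))%N ws ->
  all (fun w => large_residue d w.1) ws -> root (pZto F (altsum n ws)) z.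
Proof.
move=> ws_n /allP large; rewrite /root /altsum rmorph_sum horner_sum; apply/eqP.
apply: (big_symrange_flip (prim_order_gt0 zP)) => [k nk|l j jd].
  by rewrite (altterm_out ws_n nk) rmorph0 horner0.
rewrite !altterm_at qsign_flip // mulNr; congr (- (_ * _)).
by apply: eq_big_seq => w /large w_large; rewrite qbin_at_flip.
Qed.

Lemma XsubC_exp_dvd_altterm (k : nat) :
  ('X - z%:P) ^+ (\sum_(w <- ws) w.2 * carry d w.1 k) %| pZto F (altterm ws k%:Z).
Proof.
rewrite /altterm rmorphM dvdp_mull // rmorph_prod -prodrXr.
elim/big_ind2: _ => [|p1 q1 p2 q2|w _]; [exact: dvdpp | exact: dvdp_mul |].
rewrite rmorphXn mulnC exprM dvdp_exp2r //=.
case: (leqP k w.1) => kw; last by rewrite qbin_out ?rmorph0 ?dvdp0 //; lia.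
rewrite -mup_geq ?(mup_qbin_central zP) // map_intr_poly_eq0 -PoszD.
by rewrite qbin_neq0 //; lia.
Qed.

Lemma XsubC_exp_dvd_1addXn (k : nat) :
  ('X - z%:P) ^+ ((k %% d).*2 == d) %| pZto F (1 + 'X^k).
Proof.
case: eqP => [k_half|_]; last exact: dvd1p.
rewrite dvdp_XsubCl /root rmorphD rmorph1 /= map_polyXn !hornerE.
by rewrite -(prim_expr_mod zP) (prim_expr_half zP (esym k_half)) subrr.
Qed.

Lemma mup_altsum_ge e : altsum n ws != 0 ->
  (forall k, (k <= n)%N ->
     (e <= \sum_(w <- ws) w.2 * carry d w.1 k + ((k %% d).*2 == d))%N) ->
  (e <= mup z (pZto F (altsum n ws)))%N.
Proof.
move=> S0 e_le; rewrite mup_geq ?map_intr_poly_eq0 //.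
have dvd_pair k : (k <= n)%N ->
    ('X - z%:P) ^+ e %| pZto F (altterm ws k%:Z * (1 + 'X^k)).
  move=> /e_le/(dvdp_exp2l ('X - z%:P))/dvdp_trans; apply.
  by rewrite exprD rmorphM dvdp_mul ?XsubC_exp_dvd_altterm ?XsubC_exp_dvd_1addXn //.
rewrite /altsum big_symrange_fold rmorphD rmorph_sum /=; apply: dvdp_add.
  have := dvd_pair 0%N isT; rewrite expr0 rmorphM /=.
  by rewrite -[1 + 1]/(2%:R) rmorph_nat -polyC_natr mulrC mul_polyC dvdpZr // pnatr_eq0.
rewrite big_nat; elim/big_ind: _ => [|p q|k /andP[_ kn]].
- exact: dvdp0.
- exact: dvdp_add.
by rewrite altterm_opp -{1}[altterm _ _]mulr1 -mulrDr dvd_pair.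
Qed.

Lemma mup_altsum_gt0 : altsum n ws != 0 -> has (fun w => w.1 <= n)%N ws ->
  all (fun w => 0 < w.2)%N ws ->
  (forall k, (k <= n)%N -> all (fun w => ~~ carry d w.1 k) ws ->
     all (fun w => large_residue d w.1) ws) ->
  (0 < mup z (pZto F (altsum n ws)))%N.
Proof.
move=> S0 /hasP[c c_ws cn] /allP ws_gt0 no_carry_large.
have [large|small] := boolP (all (fun w => large_residue d w.1) ws).
  rewrite -XsubC_dvd ?map_intr_poly_eq0 // dvdp_XsubCl root_altsum_large //.
  by apply/hasP; exists c; rewrite ?cn ?ws_gt0.
apply: mup_altsum_ge => // k kn.
have /allPn[w w_ws w_carry] : ~~ all (fun w => ~~ carry d w.1 k) ws.
  exact: contra (no_carry_large k kn) small.
by rewrite (big_rem w) //= (negPn w_carry) muln1; have := ws_gt0 w w_ws; lia.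
Qed.

End AltsumAtPrimitiveRoot.

(** * Residues of the multiples of n *)

Lemma modnM_quot d i n : (0 < d)%N -> (0 < i)%N ->
  exists j, [/\ (j < i)%N, (j * d <= i * (n %% d) < j.+1 * d)%N
    & ((i * n) %% d = i * (n %% d) - j * d)%N].
Proof.
move=> d_gt0 i_gt0; exists ((i * (n %% d)) %/ d)%N; split.
- by rewrite ltn_divLR // ltn_pmul2l // ltn_pmod.
- by rewrite leq_trunc_div ltn_ceil.
- by rewrite -modnMmr {2}(divn_eq (i * (n %% d)) d) addKn.
Qed.

(* With x = (n %% d) / d and w = dist_multiple d k / d, the absence of a carry at
   n, 2n and 3n (resp. 4n) bounds w by piecewise linear functions of x. These
   bounds are compatible only for x in finitely many intervals. On the last one,
   [5/6, 1[ (resp. [7/8, 1[), all residues are large; the others are listed here. *)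
Definition exceptional3 (d v : nat) : bool :=
  [|| 6 * v < d, (2 * d <= 5 * v) && (2 * v < d)
    | (4 * d <= 5 * v) && (6 * v < 5 * d)]%N.

Definition exceptional4 (d v : nat) : bool :=
  [|| 8 * v < d, (d <= 5 * v) && (4 * v < d), (d <= 3 * v) && (8 * v < 3 * d),
      (2 * d <= 5 * v) && (2 * v < d), (2 * d <= 3 * v) && (4 * v < 3 * d)
    | (5 * d <= 6 * v) && (8 * v < 7 * d)]%N.

Lemma no_carry3_exceptional_or_large d n k : (0 < d)%N ->
  ~~ carry d (3 * n) k -> ~~ carry d (2 * n) k -> ~~ carry d n k ->
  exceptional3 d (n %% d)
    || [&& large_residue d (3 * n), large_residue d (2 * n) & large_residue d n].
Proof.
move=> d_gt0; rewrite /carry /large_residue /exceptional3.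
have := ltn_pmod n d_gt0.
have [j2 [j2_lt j2_bd ->]] := @modnM_quot d 2 n d_gt0 isT.
have [j3 [j3_lt j3_bd ->]] := @modnM_quot d 3 n d_gt0 isT.
move: (n %% d)%N (dist_multiple d k) j2_bd j3_bd => v w j2_bd j3_bd vd.
case: j2 j3 j2_lt j3_lt j2_bd j3_bd => [|[|//]] [|[|[|//]]] _ _ j2_bd j3_bd;
  do 3! [case: ifP => ?]; lia.
Qed.

Lemma no_carry4_exceptional_or_large d n k : (0 < d)%N ->
  ~~ carry d (4 * n) k -> ~~ carry d (2 * n) k -> ~~ carry d n k ->
  exceptional4 d (n %% d)
    || [&& large_residue d (4 * n), large_residue d (2 * n) & large_residue d n].
Proof.
move=> d_gt0; rewrite /carry /large_residue /exceptional4.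
have := ltn_pmod n d_gt0.
have [j2 [j2_lt j2_bd ->]] := @modnM_quot d 2 n d_gt0 isT.
have [j4 [j4_lt j4_bd ->]] := @modnM_quot d 4 n d_gt0 isT.
move: (n %% d)%N (dist_multiple d k) j2_bd j4_bd => v w j2_bd j4_bd vd.
case: j2 j4 j2_lt j4_lt j2_bd j4_bd => [|[|//]] [|[|[|[|//]]]] _ _ j2_bd j4_bd;
  do 3! [case: ifP => ?]; lia.
Qed.

Lemma carry_1_5_nonexceptional3 d n : (0 < d)%N ->
  (d <= n %% d + (5 * n) %% d)%N -> ~~ exceptional3 d (n %% d).
Proof.
move=> d_gt0; rewrite /exceptional3.
have [j5 [j5_lt j5_bd ->]] := @modnM_quot d 5 n d_gt0 isT; have := ltn_pmod n d_gt0.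
move: (n %% d)%N j5_bd => v j5_bd vd.
by case: j5 j5_lt j5_bd => [|[|[|[|[|//]]]]] _ j5_bd; lia.
Qed.

Lemma large_residue_nonexceptional3 d n : (0 < d)%N ->
  large_residue d (3 * n) -> ~~ exceptional3 d (n %% d).
Proof.
move=> d_gt0; rewrite /exceptional3 /large_residue.
have [j3 [j3_lt j3_bd ->]] := @modnM_quot d 3 n d_gt0 isT; have := ltn_pmod n d_gt0.
move: (n %% d)%N j3_bd => v j3_bd vd.
by case: j3 j3_lt j3_bd => [|[|[|//]]] _ j3_bd; lia.
Qed.

Lemma dvdn_nonexceptional3 d n : (0 < d)%N ->
  (d %| 3 * n)%N -> ~~ (d %| n)%N -> ~~ exceptional3 d (n %% d).
Proof.
move=> d_gt0; rewrite /exceptional3 /dvdn.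
have [j3 [j3_lt j3_bd ->]] := @modnM_quot d 3 n d_gt0 isT; have := ltn_pmod n d_gt0.
move: (n %% d)%N j3_bd => v j3_bd vd.
by case: j3 j3_lt j3_bd => [|[|[|//]]] _ j3_bd; lia.
Qed.

Lemma carry_3_5_nonexceptional4 d n : (0 < d)%N ->
  (d <= (3 * n) %% d + (5 * n) %% d)%N -> ~~ exceptional4 d (n %% d).
Proof.
move=> d_gt0; rewrite /exceptional4.
have [j3 [j3_lt j3_bd ->]] := @modnM_quot d 3 n d_gt0 isT.
have [j5 [j5_lt j5_bd ->]] := @modnM_quot d 5 n d_gt0 isT.
have := ltn_pmod n d_gt0; move: (n %% d)%N j3_bd j5_bd => v j3_bd j5_bd vd.
case: j3 j5 j3_lt j5_lt j3_bd j5_bd => [|[|[|//]]] [|[|[|[|[|//]]]]] _ _ j3_bd j5_bd;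
  lia.
Qed.

Lemma modn_logn2_half n : (0 < n)%N ->
  (n %% 2 ^ (logn 2 n).+1).*2 = (2 ^ (logn 2 n).+1)%N.
Proof.
move=> n_gt0; have [m m_odd nE] := pfactor_coprime (isT : prime 2) n_gt0.
rewrite {1}nE expnS -muln_modl (_ : m %% 2 = 1)%N ?mul1n -?mul2n //.
by rewrite modn2 -coprime2n m_odd.
Qed.

Lemma large_residue_3pow2 a n : (n = 3 * 2 ^ a %[mod 2 ^ (a + 2)])%N ->
  large_residue (2 ^ a.+2) n.
Proof.
rewrite /large_residue addn2 => ->; have : (0 < 2 ^ a)%N by rewrite expn_gt0.
by rewrite modn_small !expnS; lia.
Qed.

Lemma small_residue_pow2 a n : (n = 2 ^ a %[mod 2 ^ (a + 2)])%N ->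
  ~~ large_residue (2 ^ a.+3) (2 * n).
Proof.
rewrite /large_residue addn2 => nE; have : (0 < 2 ^ a)%N by rewrite expn_gt0.
by rewrite expnS -muln_modr nE modn_small !expnS; lia.
Qed.

(** * The sums of the theorem *)

Definition triple_altsum (c n r s t : nat) : {poly int} :=
  altsum n [:: (c * n, r); (2 * n, s); (n, t)]%N.

Lemma triple_altsumE c n r s t : triple_altsum c n r s t
  = \sum_(k <- symrange n) (-1) ^ k * 'X^(zbin2 k)
      * qbin (2 * (c * n)) ((c * n)%:Z + k) ^+ r
      * qbin (2 * (2 * n)) ((2 * n)%:Z + k) ^+ s
      * qbin (2 * n) (n%:Z + k) ^+ t.
Proof.
by apply: eq_bigr => k _; rewrite /altterm !big_cons big_nil mulr1 !mulrA.
Qed.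

Section TripleAltsum.

Variables (F : numFieldType) (d : nat) (z : F) (c n r s t : nat).
Hypothesis zP : d.-primitive_root z.

Lemma mup_triple_ge e : triple_altsum c n r s t != 0 ->
  (forall k, (k <= n)%N ->
     (e <= r * carry d (c * n) k + s * carry d (2 * n) k + t * carry d n k
           + ((k %% d).*2 == d))%N) ->
  (e <= mup z (pZto F (triple_altsum c n r s t)))%N.
Proof.
move=> S0 e_le; apply: (mup_altsum_ge zP) => // k /e_le.
by rewrite !big_cons big_nil /= addn0 !addnA.
Qed.

Hypotheses (r_gt0 : (0 < r)%N) (s_gt0 : (0 < s)%N) (t_gt0 : (0 < t)%N).

Lemma mup_triple_gt0 : triple_altsum c n r s t != 0 ->
  (forall k, ~~ carry d (c * n) k -> ~~ carry d (2 * n) k -> ~~ carry d n k ->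
     [&& large_residue d (c * n), large_residue d (2 * n) & large_residue d n]) ->
  (0 < mup z (pZto F (triple_altsum c n r s t)))%N.
Proof.
move=> S0 no_carry_large; apply: (mup_altsum_gt0 zP) => //=.
- by rewrite leqnn !orbT.
- by rewrite r_gt0 s_gt0 t_gt0.
by move=> k _; rewrite !andbT => /and3P[? ? ?]; exact: (no_carry_large k).
Qed.

End TripleAltsum.

Section TripleThreeFour.

Variables n r s t : nat.
Hypotheses (n_gt0 : (0 < n)%N) (r_gt0 : (0 < r)%N).
Hypotheses (s_gt0 : (0 < s)%N) (t_gt0 : (0 < t)%N).

Local Notation triple3 := (triple_altsum 3 n r s t).
Local Notation triple4 := (triple_altsum 4 n r s t).

Lemma mup_triple3_gt0 (F : numFieldType) d (z : F) :
  d.-primitive_root z -> triple3 != 0 -> ~~ exceptional3 d (n %% d) ->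
  (0 < mup z (pZto F triple3))%N.
Proof.
move=> zP S0 /negPf not_exc; apply: (mup_triple_gt0 zP) => // k c3 c2 c1.
by have := no_carry3_exceptional_or_large (prim_order_gt0 zP) c3 c2 c1; rewrite not_exc.
Qed.

Lemma mup_triple4_gt0 (F : numFieldType) d (z : F) :
  d.-primitive_root z -> triple4 != 0 -> ~~ exceptional4 d (n %% d) ->
  (0 < mup z (pZto F triple4))%N.
Proof.
move=> zP S0 /negPf not_exc; apply: (mup_triple_gt0 zP) => // k c4 c2 c1.
by have := no_carry4_exceptional_or_large (prim_order_gt0 zP) c4 c2 c1; rewrite not_exc.
Qed.

Lemma mup_triple3_gt1 (F : numFieldType) (z : F) :
  (2 ^ (logn 2 n).+1).-primitive_root z -> triple3 != 0 ->
  (1 < mup z (pZto F triple3))%N.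
Proof.
set d := (2 ^ _)%N => zP S0; have d_gt0 := prim_order_gt0 zP.
have half1 : (n %% d).*2 = d by exact: modn_logn2_half.
have half3 : ((3 * n) %% d).*2 = d.
  have := @modn_logn2_half (3 * n); rewrite lognM // (_ : logn 2 3 = 0)%N // add0n.
  by apply; rewrite muln_gt0.
have dvd2 : (d %| 2 * n)%N by rewrite /d expnS dvdn_pmul2l // pfactor_dvdnn.
apply: (mup_triple_ge zP) => // k _.
rewrite (carry_dvdl _ _ dvd2) // !carry_halfl //.
have [/eqP|_] := boolP (d %| k)%N; case: eqP => ? /=; lia.
Qed.

Lemma mup_triple4_gt1_order1 (F : numFieldType) (z : F) :
  (2 ^ (logn 2 n).+1).-primitive_root z -> (1 < t)%N -> triple4 != 0 ->
  (1 < mup z (pZto F triple4))%N.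
Proof.
set d := (2 ^ _)%N => zP t_gt1 S0; have d_gt0 := prim_order_gt0 zP.
have half1 : (n %% d).*2 = d by exact: modn_logn2_half.
have dvd2 : (d %| 2 * n)%N by rewrite /d expnS dvdn_pmul2l // pfactor_dvdnn.
have dvd4 : (d %| 4 * n)%N by rewrite -[4%N]/(2 * 2)%N -mulnA dvdn_mull.
apply: (mup_triple_ge zP) => // k _.
rewrite (carry_dvdl _ _ dvd2) // (carry_dvdl _ _ dvd4) // carry_halfl //.
have [/eqP|_] := boolP (d %| k)%N; case: eqP => ? /=; lia.
Qed.

Lemma mup_triple4_gt1_order2 (F : numFieldType) (z : F) :
  (2 ^ (logn 2 n).+2).-primitive_root z ->
  (1 < s)%N || large_residue (2 ^ (logn 2 n).+2) n -> triple4 != 0 ->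
  (1 < mup z (pZto F triple4))%N.
Proof.
set d := (2 ^ _)%N => zP s_or_large S0; have d_gt0 := prim_order_gt0 zP.
have half2 : ((2 * n) %% d).*2 = d.
  by have := @modn_logn2_half (2 * n); rewrite lognM // muln_gt0; apply.
have dvd4 : (d %| 4 * n)%N by rewrite /d !expnS mulnA dvdn_pmul2l // pfactor_dvdnn.
apply: (mup_triple_ge zP) => // k _.
rewrite (carry_dvdl _ _ dvd4) // [carry d (2 * n) k]carry_halfl //.
have [dvd_k|ndvd_k] := boolP (d %| k)%N; last by case: eqP => ? /=; lia.
rewrite [carry d n k]carry_dvdr // (eqP dvd_k) eq_sym gtn_eqF //.
by case/orP: s_or_large => [s_gt1|->]; lia.
Qed.

Lemma mup_triple4_gt1_order3 (F : numFieldType) (z : F) :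
  (2 ^ (logn 2 n).+3).-primitive_root z -> (1 < r)%N ->
  ~~ large_residue (2 ^ (logn 2 n).+3) (2 * n) -> triple4 != 0 ->
  (1 < mup z (pZto F triple4))%N.
Proof.
set d := (2 ^ _)%N => zP r_gt1 small2 S0; have d_gt0 := prim_order_gt0 zP.
have half4 : ((4 * n) %% d).*2 = d.
  by have := @modn_logn2_half (4 * n); rewrite lognM // muln_gt0; apply.
apply: (mup_triple_ge zP) => // k _; rewrite [carry d (4 * n) k]carry_halfl //.
have [k_half|_] := eqVneq (k %% d).*2 d; last by lia.
by rewrite [carry d (2 * n) k]carry_halfr // small2; lia.
Qed.

Lemma qdiv_congr0_6n_n :
  qdiv_congr0 (qbin (6 * n) n%:Z) triple3 (qnat_pow 2 (2 ^ logn 2 n)).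
Proof.
apply: (@qdiv_congr0_qbin_qnat_pow algC) => // [|d z zP S0|z zP S0]; first by lia.
  rewrite (_ : 6 * n - n = 5 * n)%N => [carry15|]; last by lia.
  apply: (mup_triple3_gt0 zP) => //.
  exact: carry_1_5_nonexceptional3 (prim_order_gt0 zP) carry15.
exact: mup_triple3_gt1.
Qed.

Lemma qdiv_congr0_8n_3n e :
  (forall z : algC, (2 ^ e.+1).-primitive_root z -> triple4 != 0 ->
     (1 < mup z (pZto algC triple4))%N) ->
  qdiv_congr0 (qbin (8 * n) (3 * n)%:Z) triple4 (qnat_pow 2 (2 ^ e)).
Proof.
move=> double; apply: (@qdiv_congr0_qbin_qnat_pow algC) => // [|d z zP S0].
  by lia.
rewrite (_ : 8 * n - 3 * n = 5 * n)%N => [carry35|]; last by lia.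
apply: (mup_triple4_gt0 zP) => //.
exact: carry_3_5_nonexceptional4 (prim_order_gt0 zP) carry35.
Qed.

Lemma qdiv_congr0_6n_3n :
  qdiv_congr0 (qbin (6 * n) (3 * n)%:Z) triple3
    (qnat_pow 2 (2 ^ logn 2 n) * qnat_pow 3 (3 ^ logn 3 n)).
Proof.
apply: (@qdiv_congr0_mup algC) => [||d z zP S0].
- by apply: unity_rooted_qbin; lia.
- by apply/unity_rootedM; split; apply: unity_rooted_qnat_pow_prime.
have d_gt0 := prim_order_gt0 zP.
rewrite (mup_qnat_pow_primeM _ _ _ _ zP) // (mup_qbin zP); last by lia.
rewrite (_ : 6 * n - 3 * n = 3 * n)%N ?addnn -?mul2n; last by lia.
case: (d =P _) => [dE|_].
  have /negPf-> : d != (3 ^ (logn 3 n).+1)%N.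
    by rewrite dE; apply/eqP => /(congr1 odd); rewrite !oddX.
  by rewrite dE in zP *; apply: leq_trans (mup_triple3_gt1 zP S0); rewrite ltnS leq_b1.
case: (d =P _) => [dE|_].
  have dvd3 : (d %| 3 * n)%N by rewrite dE expnS dvdn_pmul2l // pfactor_dvdnn.
  rewrite (eqP dvd3) muln0 leqn0 (gtn_eqF d_gt0) addn0.
  apply: (mup_triple3_gt0 zP) => //; apply: dvdn_nonexceptional3 => //.
  by rewrite dE pfactor_dvdn // ltnn.
case: (leqP d (2 * _)) => // large3; apply: (mup_triple3_gt0 zP) => //.
exact: large_residue_nonexceptional3.
Qed.

End TripleThreeFour.

Theorem theorem2 (n r s t : nat) (hn : (0 < n)%N) (hr : (0 < r)%N)
    (hs : (0 < s)%N) (ht : (0 < t)%N) :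
  let alpha := logn 2 n in
  let beta := logn 3 n in
  let S6 : {poly int} :=
    \sum_(k <- symrange n) (-1) ^ k * 'X^(zbin2 k)
      * qbin (6 * n) ((3 * n)%:Z + k) ^+ r
      * qbin (4 * n) ((2 * n)%:Z + k) ^+ s
      * qbin (2 * n) (n%:Z + k) ^+ t in
  let S8 : {poly int} :=
    \sum_(k <- symrange n) (-1) ^ k * 'X^(zbin2 k)
      * qbin (8 * n) ((4 * n)%:Z + k) ^+ r
      * qbin (4 * n) ((2 * n)%:Z + k) ^+ s
      * qbin (2 * n) (n%:Z + k) ^+ t in
  [/\ qdiv_congr0 (qbin (6 * n) n%:Z) S6 (qnat_pow 2 (2 ^ alpha)),
      qdiv_congr0 (qbin (6 * n) (3 * n)%:Z) S6
        (qnat_pow 2 (2 ^ alpha) * qnat_pow 3 (3 ^ beta))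
    & [/\ (2 <= t)%N ->
            qdiv_congr0 (qbin (8 * n) (3 * n)%:Z) S8 (qnat_pow 2 (2 ^ alpha)),
          (2 <= s)%N
            \/ ((2 <= r)%N /\ (n = 3 * 2 ^ alpha %[mod 2 ^ (alpha + 2)])%N) ->
            qdiv_congr0 (qbin (8 * n) (3 * n)%:Z) S8
              (qnat_pow 2 (2 ^ (alpha + 1)))
        & (2 <= r)%N -> (n = 2 ^ alpha %[mod 2 ^ (alpha + 2)])%N ->
            qdiv_congr0 (qbin (8 * n) (3 * n)%:Z) S8
              (qnat_pow 2 (2 ^ (alpha + 2)))]].
Proof.
move=> alpha beta S6 S8.
have -> : S6 = triple_altsum 3 n r s t by rewrite triple_altsumE !mulnA.
have -> : S8 = triple_altsum 4 n r s t by rewrite triple_altsumE !mulnA.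
split; [exact: qdiv_congr0_6n_n | exact: qdiv_congr0_6n_3n | split].
- by move=> t_gt1; apply: qdiv_congr0_8n_3n => // z zP; apply: mup_triple4_gt1_order1.
- move=> s_or_n; rewrite addn1; apply: qdiv_congr0_8n_3n => // z zP.
  apply: mup_triple4_gt1_order2 => //.
  by case: s_or_n => [->|[_ /large_residue_3pow2->]]; rewrite ?orbT.
- move=> r_gt1 n_mod; rewrite addn2; apply: qdiv_congr0_8n_3n => // z zP.
  by apply: mup_triple4_gt1_order3 => //; apply: small_residue_pow2.
Qed.
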